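(* Let $A_1,A_2\in\mathbb{R}^{2\times2}$ and let $P_0,P_1,P_2$ be three totally-real planes in $\mathbb{C}^2$ given by $$P_0=\mathbb{R}^2,\qquad P_j=(A_j+i\mathbb{I})\mathbb{R}^2,\quad j=1,2.$$ Assume that the pairwise unions of $P_0,P_1,P_2$ are locally polynomially convex at $0\in\mathbb{C}^2$. Assume further that (i) $\det[A_1,A_2]>0$; (ii) $\det A_j<0$ for $j=1,2$; (iii) $\beta(A_1,A_2)>\min\{\det A_2\,(\operatorname{Tr}A_1)^2,\ \det A_1\,(\operatorname{Tr}A_2)^2\}$, where $$\beta(A_1,A_2):=4\det(A_1A_2)-\operatorname{Tr}(A_1A_2)\big(\operatorname{Tr}(A_1A_2)-\operatorname{Tr}A_1\operatorname{Tr}A_2\big)-\tfrac14(\operatorname{Tr}A_1\operatorname{Tr}A_2)^2.$$ Then $P_0\cup P_1\cup P_2$ is locally polynomially convex at the origin.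
   Context: $\mathbb{I}$ is the $2\times2$ identity matrix and $[A_1,A_2]=A_1A_2-A_2A_1$. A plane is a 2-dimensional real subspace $P$ of $\mathbb{C}^2$; it is totally real if $P\cap iP=\{0\}$. For a compact set $K\subset\mathbb{C}^n$, the polynomially convex hull is $\widehat{K}=\{z\in\mathbb{C}^n: |p(z)|\le\sup_K|p| \text{ for all } p\in\mathbb{C}[z_1,\dots,z_n]\}$; $K$ is polynomially convex if $\widehat{K}=K$. A closed set $E\subset\mathbb{C}^n$ is locally polynomially convex at $p\in E$ if $E\cap\overline{B(p;r)}$ is polynomially convex for some $r>0$, where $B(p;r)$ is the open ball with centre $p$ and radius $r$. *)

(* Defs.v *)
From mathcomp Require Import all_boot all_order all_algebra.
From mathcomp Require Import complex.
From mathcomp Require mpoly.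
From mathcomp Require Import boolp classical_sets reals constructive_ereal ereal.

Set Implicit Arguments.
Unset Strict Implicit.
Unset Printing Implicit Defensive.
Import Order.TTheory GRing.Theory Num.Theory.

Local Open Scope classical_set_scope.
Local Open Scope complex_scope.
Local Open Scope ring_scope.

(* C^n is the type of column vectors 'cV[R[i]]_n; the topology is not needed,
   since balls are taken for the Euclidean norm below and not for the max norm
   that MathComp-Analysis puts on matrices. *)
Definition enorm (R : realType) (n : nat) (z : 'cV[R[i]]_n) : R :=
  Num.sqrt (\sum_(k < n) Normc.normc (z k 0) ^+ 2).

Definition eclosed_ball (R : realType) (n : nat) (p : 'cV[R[i]]_n) (r : R) :
    set 'cV[R[i]]_n :=
  [set z | enorm (z - p) <= r].

(* [mpoly.mpoly n R[i]] is {mpoly R[i][n]} and [mpoly.meval] is its evaluation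
   (p.@[z]); the file is not imported because its notations clash with those of
   MathComp-Analysis. *)
Definition peval (R : realType) (n : nat) (p : mpoly.mpoly n R[i])
    (z : 'cV[R[i]]_n) : R[i] :=
  mpoly.meval (fun k => z k 0) p.

(* The supremum is taken in the extended reals; it is finite as soon as K is
   compact and nonempty, and -oo for K = set0, so that the hull of set0 is
   set0. *)
Definition polynomial_hull (R : realType) (n : nat) (K : set 'cV[R[i]]_n) :
    set 'cV[R[i]]_n :=
  [set z | forall p : mpoly.mpoly n R[i],
     ((Normc.normc (peval p z))%:E <=
        ereal_sup [set (Normc.normc (peval p w))%:E | w in K])%E].

(* Meant for compact K. *)
Definition polynomially_convex (R : realType) (n : nat)
    (K : set 'cV[R[i]]_n) : Prop :=
  polynomial_hull K = K.

(* Meant for closed E and p in E. *)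
Definition locally_polynomially_convex_at (R : realType) (n : nat)
    (E : set 'cV[R[i]]_n) (p : 'cV[R[i]]_n) : Prop :=
  exists2 r : R, 0 < r & polynomially_convex (E `&` eclosed_ball p r).

Definition is_plane (R : realType) (P : set 'cV[R[i]]_2) : Prop :=
  exists u v : 'cV[R[i]]_2,
    (forall a b : R, a%:C *: u + b%:C *: v = 0 -> a = 0 /\ b = 0) /\
    P = [set z | exists a b : R, z = a%:C *: u + b%:C *: v].

Definition totally_real_plane (R : realType) (P : set 'cV[R[i]]_2) : Prop :=
  is_plane P /\ P `&` [set 'i%C *: z | z in P] = [set 0].

Definition real_plane (R : realType) : set 'cV[R[i]]_2 :=
  [set map_mx (real_complex R) x | x in [set: 'cV[R]_2]].

Arguments real_plane : clear implicits.

Definition plane_of_mx (R : realType) (A : 'M[R]_2) : set 'cV[R[i]]_2 :=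
  [set (map_mx (real_complex R) A + 'i%C%:M) *m map_mx (real_complex R) x
     | x in [set: 'cV[R]_2]].

Definition mx_commutator (R : realType) (A1 A2 : 'M[R]_2) : 'M[R]_2 :=
  A1 *m A2 - A2 *m A1.

Definition beta (R : realType) (A1 A2 : 'M[R]_2) : R :=
  4 * \det (A1 *m A2)
  - \tr (A1 *m A2) * (\tr (A1 *m A2) - \tr A1 * \tr A2)
  - 4^-1 * (\tr A1 * \tr A2) ^+ 2.

(* Main.v *)
Require Import Defs.
From mathcomp Require Import all_boot all_order all_algebra.
From mathcomp Require Import complex ring lra.
From mathcomp Require mpoly.
From mathcomp Require Import boolp classical_sets reals constructive_ereal ereal.
Import (canonicals) mpoly.

(** Kallin's method, made elementary for one explicit polynomial. Let
    [p z = det (z, A1 z)]. It is real on P0, it takes values in the real line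
    spanned by [det (A1 + i) = det A1 - 1 + i tr A1] on P1, and on P2 its
    imaginary part is a real quadratic form of discriminant
    [- 4 (beta A1 A2 - det A2 (tr A1)^2)], hence definite (up to exchanging A1
    and A2). So [u = p^2] maps a part Ka of K (P0 if [tr A1 <> 0], P0 and P1
    otherwise) into [0, +oo) and the rest Kb into the complement of an open
    sector around the positive half-line.
    For [c] in the sector, on either side of the half-line, pushing poles along
    [c + t], [t >= 0], shows that [1 / (c - u)] and the square root of [c - u]
    with positive real part are uniform limits of polynomials on the hull of K.
    The product S of the square roots for [c] and its conjugate is close to [u]
    on Ka and to [- u] on Kb as [c] tends to 0; so at a point of the hull of K
    where [u <> 0], one of [u - S], [u + S] does not vanish, and multiplying it
    by high powers of a polynomial that is small on the other part puts the
    point in the hull of Ka or of Kb. Points of the hull of K where [u = 0] are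
    treated in the same way with [c / (c - u)], which is 1 there and small on P2
    away from 0; they lie in the hull of the part of K in P0 and P1. *)

Set Implicit Arguments.
Unset Strict Implicit.
Unset Printing Implicit Defensive.
Import Order.TTheory GRing.Theory Num.Theory.

Local Open Scope classical_set_scope.
Local Open Scope complex_scope.
Local Open Scope ring_scope.

Local Notation nrm := Normc.normc.
Local Notation Re := (@complex.Re _).
Local Notation Im := (@complex.Im _).

(** * The norm of [R[i]] *)

Section ComplexNorm.
Variable R : realType.
Implicit Types (x y : R[i]) (r : R).

Lemma sqr_nrm x : nrm x ^+ 2 = Re x ^+ 2 + Im x ^+ 2.
Proof. by case: x => a b /=; rewrite sqr_sqrtr // addr_ge0 ?sqr_ge0. Qed.

Lemma nrm_ge0 x : 0 <= nrm x.
Proof. by case: x => a b /=; rewrite sqrtr_ge0. Qed.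

Lemma nrmB x y : nrm (x - y) <= nrm x + nrm y.
Proof. by rewrite -(normcN y); exact: le_normcD. Qed.

Lemma nrmX x n : nrm (x ^+ n) = nrm x ^+ n.
Proof. by elim: n => [|n IH]; rewrite ?Normc.normc1 // !exprS Normc.normcM IH. Qed.

Lemma ler_nrm x r : 0 <= r -> (nrm x <= r) = (Re x ^+ 2 + Im x ^+ 2 <= r ^+ 2).
Proof. by move=> r0; rewrite -sqr_nrm ler_sqr // nnegrE nrm_ge0. Qed.

Lemma normr_Re_le_nrm x : `|Re x| <= nrm x.
Proof.
by rewrite -ler_sqr ?nnegrE ?nrm_ge0 // sqr_nrm real_normK ?num_real // lerDl sqr_ge0.
Qed.

Lemma normr_Im_le_nrm x : `|Im x| <= nrm x.
Proof.
by rewrite -ler_sqr ?nnegrE ?nrm_ge0 // sqr_nrm real_normK ?num_real // lerDr sqr_ge0.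
Qed.

Lemma nrm_le_ReIm x : nrm x <= `|Re x| + `|Im x|.
Proof.
rewrite ler_nrm ?addr_ge0 // -(real_normK (num_real (Re x))) -(real_normK (num_real (Im x))).
by have := mulr_ge0 (normr_ge0 (Re x)) (normr_ge0 (Im x)); nra.
Qed.

Lemma nrm_real r : nrm r%:C = `|r|.
Proof. by rewrite /= expr0n /= addr0 sqrtr_sqr. Qed.

Lemma nrm_gt0 x : (0 < nrm x) = (x != 0).
Proof.
rewrite lt_def nrm_ge0 andbT; congr negb; apply/eqP/eqP => [/Normc.eq0_normc //|->].
exact: Normc.normc0.
Qed.

(** Bernoulli's inequality gives [a ^+ n <= 1 / (1 + n * t)] with [t = 1 - a]; the Archimedean
    property provides [n]. *)
Lemma expr_le_eps (a e : R) : 0 <= a < 1 -> 0 < e -> exists n, a ^+ n <= e.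
Proof.
move=> /andP[a0 a1] e0; set t := 1 - a.
have t0 : 0 < t by rewrite /t subr_gt0.
have bern n : a ^+ n * (1 + n%:R * t) <= 1.
  elim: n => [|n IH]; first by rewrite expr0 mul0r addr0 mulr1.
  apply: le_trans IH; rewrite exprS mulrAC mulrC; apply: ler_wpM2l; first exact: exprn_ge0.
  have -> : a = 1 - t by rewrite /t; ring.
  have n0 : 0 <= n%:R :> R by exact: ler0n.
  have tt : 0 <= n%:R * t ^+ 2 by rewrite mulr_ge0 ?sqr_ge0.
  by rewrite -natr1; nra.
exists (Num.bound (t * e)^-1).
have te : 0 < t * e by rewrite mulr_gt0.
have /ltW : (t * e)^-1 < (Num.bound (t * e)^-1)%:R by rewrite archi_boundP // invr_ge0 ltW.
move: (Num.bound _) => n hn.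
have {}hn : 1 <= e * (1 + n%:R * t).
  have : 1 <= n%:R * (t * e) by rewrite -ler_pdivrMr // div1r.
  by nra.
rewrite -(@ler_pM2r _ (1 + n%:R * t)); last by rewrite ltr_wpDr // mulr_ge0 // ltW.
exact: le_trans (bern n) hn.
Qed.
End ComplexNorm.

(** * Polynomial hulls *)

Section Hull.
Variables (R : realType) (n : nat).
Implicit Types (K Y : set 'cV[R[i]]_n) (f g : 'cV[R[i]]_n -> R[i]) (z : 'cV[R[i]]_n).

Lemma pevalC c z : peval (mpoly.mpolyC n c) z = c.
Proof. exact: mpoly.mevalC. Qed.

Lemma pevalD (p q : mpoly.mpoly n R[i]) z : peval (p + q) z = peval p z + peval q z.
Proof. exact: mpoly.mevalD. Qed.

Lemma pevalN (p : mpoly.mpoly n R[i]) z : peval (- p) z = - peval p z.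
Proof. exact: mpoly.mevalN. Qed.

Lemma pevalM (p q : mpoly.mpoly n R[i]) z : peval (p * q) z = peval p z * peval q z.
Proof. exact: mpoly.mevalM. Qed.

Lemma pevalXn (p : mpoly.mpoly n R[i]) z k : peval (p ^+ k) z = peval p z ^+ k.
Proof. by elim: k => [|k IH]; rewrite ?exprS ?pevalM ?IH // !expr0 -(pevalC 1 z). Qed.

(** Induction on polynomial functions, for properties that pass to sums and products such as
    boundedness and continuity. *)
Lemma peval_ind (Q : ('cV[R[i]]_n -> R[i]) -> Prop) :
  (forall c, Q (fun=> c)) -> (forall k, Q (fun z => z k 0)) ->
  (forall f g, Q f -> Q g -> Q (fun z => f z + g z)) ->
  (forall f g, Q f -> Q g -> Q (fun z => f z * g z)) ->
  forall p : mpoly.mpoly n R[i], Q (peval p).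
Proof.
move=> Qc Qx QD QM; apply: mpoly.mpolyind => [|c m p _ _ Qp].
  by have -> : peval (0 : mpoly.mpoly n R[i]) = fun=> 0 by apply/funext => z; exact: mpoly.meval0.
have -> : peval (c *: mpoly.mpolyX R[i] m + p) =
    fun z => c * (\prod_(k < n) z k 0 ^+ mpoly.fun_of_multinom m k) + peval p z.
  by apply/funext => z; rewrite pevalD /peval mpoly.mevalZ mpoly.mevalX.
apply: QD => //; apply: (QM (fun=> c)) => //.
elim: (index_enum _) => [|k s IH].
  by under eq_fun do rewrite big_nil.
under eq_fun do rewrite big_cons.
apply: (QM) => //.
elim: (mpoly.fun_of_multinom m k) => [|l IHl]; first by under eq_fun do rewrite expr0.
under eq_fun do rewrite exprS.
exact: QM.
Qed.

Definition coord_bounded K := exists C : R, forall z, K z -> forall k, nrm (z k 0) <= C.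

Lemma peval_bounded K (p : mpoly.mpoly n R[i]) :
  coord_bounded K -> exists2 M, 0 <= M & forall z, K z -> nrm (peval p z) <= M.
Proof.
move=> [C hC]; move: p; apply: (peval_ind (Q := fun f => exists2 M, 0 <= M & forall z, K z -> nrm (f z) <= M)) =>
  [c|k|f g [M M0 hM] [N N0 hN]|f g [M M0 hM] [N N0 hN]].
- by exists (nrm c) => //; exact: nrm_ge0.
- exists `|C| => // z Kz; exact: le_trans (hC _ Kz k) (ler_norm _).
- exists (M + N); rewrite ?addr_ge0 // => z Kz.
  by apply: le_trans (le_normcD _ _) _; rewrite lerD ?hM ?hN.
- exists (M * N); rewrite ?mulr_ge0 // => z Kz.
  by rewrite Normc.normcM ler_pM ?nrm_ge0 ?hM ?hN.
Qed.

Lemma peval_continuous0 (p : mpoly.mpoly n R[i]) (e : R) : 0 < e ->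
  exists2 d, 0 < d & forall z, (forall k, nrm (z k 0) <= d) ->
    nrm (peval p z - peval p 0) <= e.
Proof.
move: p e; apply: (peval_ind (Q := fun f => forall e : R, 0 < e -> exists2 d, 0 < d &
  forall z, (forall k, nrm (z k 0) <= d) -> nrm (f z - f 0) <= e)) =>
  [c|k|f g hf hg|f g hf hg] e e0.
- by exists 1 => // z _; rewrite subrr Normc.normc0 ltW.
- by exists e => // z /(_ k); rewrite mxE subr0.
- have e2 : 0 < e / 2 by rewrite divr_gt0.
  have [d d0 hd] := hf _ e2; have [d' d'0 hd'] := hg _ e2.
  exists (Num.min d d'); first by rewrite lt_min d0.
  move=> z hz; rewrite opprD addrACA (splitr e); apply: le_trans (le_normcD _ _) _.
  by rewrite lerD ?hd ?hd' // => k; move: (hz k); rewrite le_min => /andP[].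
- pose a := nrm (f 0); pose b := nrm (g 0).
  have a0 : 0 <= a := nrm_ge0 _; have b0 : 0 <= b := nrm_ge0 _.
  have D0 : 0 < a + b + 1 by rewrite ltr_wpDl // addr_ge0.
  (* With [e' <= 1], the three error terms below add up to at most [e' * (a + b + 1)]. *)
  pose e' := Num.min 1 (e / (a + b + 1)).
  have e'0 : 0 < e' by rewrite lt_min ltr01 divr_gt0.
  have [d d0 hd] := hf _ e'0; have [d' d'0 hd'] := hg _ e'0.
  exists (Num.min d d'); first by rewrite lt_min d0.
  move=> z hz.
  have {}hd : nrm (f z - f 0) <= e' by apply: hd => k; move: (hz k); rewrite le_min => /andP[].
  have {}hd' : nrm (g z - g 0) <= e' by apply: hd' => k; move: (hz k); rewrite le_min => /andP[].
  have -> : f z * g z - f 0 * g 0 =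
      (f z - f 0) * (g z - g 0) + (f z - f 0) * g 0 + f 0 * (g z - g 0) by ring.
  have e'1 : e' <= 1 by rewrite ge_min lexx.
  have : e' * (a + b + 1) <= e by rewrite -ler_pdivlMr // ge_min lexx orbT.
  apply: le_trans.
  apply: le_trans (le_normcD _ _) _.
  apply: le_trans (lerD (le_normcD _ _) (lexx _)) _; rewrite !Normc.normcM -/a -/b.
  have x0 := nrm_ge0 (f z - f 0); have y0 := nrm_ge0 (g z - g 0).
  move: (nrm (f z - f 0)) (nrm (g z - g 0)) hd hd' x0 y0 => x y; nra.
Qed.

(** Real bounds [M] replace the extended supremum, which suits estimates better. *)
Definition hull K : set 'cV[R[i]]_n := [set z | forall (p : mpoly.mpoly n R[i]) (M : R),
  (forall w, K w -> nrm (peval p w) <= M) -> nrm (peval p z) <= M].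

Lemma polynomial_hullE K : K !=set0 -> polynomial_hull K = hull K.
Proof.
move=> [w0 Kw0]; apply/seteqP; split => z hz p.
  move=> M hM; rewrite -lee_fin; apply: le_trans (hz p) _.
  by apply: ub_ereal_sup => _ [w Kw <-]; rewrite lee_fin hM.
have ub w : K w -> ((nrm (peval p w))%:E <=
    ereal_sup [set (nrm (peval p w'))%:E | w' in K])%E.
  by move=> Kw; apply: ereal_sup_ubound; exists w.
case: (ereal_sup _) ub => [M ub| |/(_ _ Kw0)].
- by rewrite lee_fin; apply: hz => w /ub; rewrite lee_fin.
- by move=> _; rewrite leey.
- by rewrite leeNy_eq.
Qed.

Lemma sub_hull K : K `<=` hull K.
Proof. by move=> z Kz p M; exact. Qed.

Lemma hull_mono K K' : K `<=` K' -> hull K `<=` hull K'.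
Proof. by move=> KK' z hz p M hM; apply: hz => w /KK'; exact: hM. Qed.

(** A polynomial that violates the hull inequality is divided by its value at [z]; a high power of
    the quotient is small on [K]. *)
Lemma notin_hull K z : K !=set0 -> ~ hull K z ->
  exists2 q : mpoly.mpoly n R[i], nrm (peval q z) = 1 & forall w, K w -> nrm (peval q w) <= 2^-1.
Proof.
move=> [w0 Kw0] /existsNP[p /existsNP[M /not_implyP[hM /negP]]]; rewrite -ltNge => Mz.
have M0 : 0 <= M := le_trans (nrm_ge0 _) (hM _ Kw0).
have z0 : 0 < nrm (peval p z) := le_lt_trans M0 Mz.
have h2 : (0 : R) < 2^-1 by rewrite invr_gt0.
have [|k hk] := @expr_le_eps R (M / nrm (peval p z)) 2^-1 _ h2.
  by rewrite divr_ge0 ?nrm_ge0 //= ltr_pdivrMr // mul1r.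
have pz : (nrm (peval p z))^-1 * nrm (peval p z) = 1 by rewrite mulVf // gt_eqF.
exists ((mpoly.mpolyC n (peval p z)^-1 * p) ^+ k).
  by rewrite pevalXn nrmX pevalM pevalC Normc.normcM Normc.normcV pz expr1n.
move=> w Kw; apply: le_trans hk; rewrite pevalXn nrmX pevalM pevalC Normc.normcM Normc.normcV.
rewrite lerXn2r ?nnegrE ?mulr_ge0 ?divr_ge0 ?invr_ge0 ?nrm_ge0 //.
by rewrite mulrC ler_wpM2r ?hM // invr_ge0 nrm_ge0.
Qed.

End Hull.

(** * Uniform limits of polynomials on a hull *)

Section UniformClosure.
Variables (R : realType) (n : nat) (K : set 'cV[R[i]]_n).
Hypothesis bK : coord_bounded K.
Implicit Types (f g : 'cV[R[i]]_n -> R[i]) (z : 'cV[R[i]]_n).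

(** Approximation is uniform on the whole hull, so that the limits can be evaluated at hull points
    outside [K]. *)
Definition approx f := forall e : R, 0 < e ->
  exists p : mpoly.mpoly n R[i], forall z, hull K z -> nrm (f z - peval p z) <= e.

Lemma approx_peval p : approx (peval p).
Proof. by move=> e e0; exists p => z _; rewrite subrr Normc.normc0 ltW. Qed.

Lemma approx_cst c : approx (fun=> c).
Proof.
by move=> e e0; exists (mpoly.mpolyC n c) => z _; rewrite pevalC subrr Normc.normc0 ltW.
Qed.

Lemma approxD f g : approx f -> approx g -> approx (fun z => f z + g z).
Proof.
move=> hf hg e e0; have e2 : 0 < e / 2 by rewrite divr_gt0.
have [p hp] := hf _ e2; have [q hq] := hg _ e2; exists (p + q) => z Yz.
rewrite pevalD opprD addrACA (splitr e); apply: le_trans (le_normcD _ _) _.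
by rewrite lerD ?hp ?hq.
Qed.

Lemma approx_bounded f : approx f -> exists2 M, 0 <= M & forall z, hull K z -> nrm (f z) <= M.
Proof.
move=> /(_ 1 ltr01)[p hp]; have [M M0 hM] := peval_bounded p bK.
exists (1 + M); first by rewrite addr_ge0.
move=> z Yz; rewrite -(subrK (peval p z) (f z)); apply: le_trans (le_normcD _ _) _.
by rewrite lerD ?hp //; exact: Yz.
Qed.

Lemma approxM f g : approx f -> approx g -> approx (fun z => f z * g z).
Proof.
move=> hf hg e e0.
have [F F0 hF] := approx_bounded hf; have [G G0 hG] := approx_bounded hg.
have D0 : 0 < F + G + 1 by rewrite ltr_wpDl // addr_ge0.
pose e' := Num.min 1 (e / (F + G + 1)).
have e'0 : 0 < e' by rewrite lt_min ltr01 divr_gt0.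
have e'1 : e' <= 1 by rewrite ge_min lexx.
have e'e : e' * (F + G + 1) <= e by rewrite -ler_pdivlMr // ge_min lexx orbT.
have [p hp] := hf _ e'0; have [q hq] := hg _ e'0; exists (p * q) => z Yz.
have -> : f z * g z - peval (p * q) z =
    (f z - peval p z) * g z + (f z - (f z - peval p z)) * (g z - peval q z).
  by rewrite pevalM; ring.
apply: le_trans (le_normcD _ _) _; rewrite !Normc.normcM.
have h := nrmB (f z) (f z - peval p z).
move: {hp hq hF hG}(hp _ Yz) (hq _ Yz) (hF _ Yz) (hG _ Yz) h.
move: (nrm_ge0 (f z - peval p z)) (nrm_ge0 (g z - peval q z)) (nrm_ge0 (f z)) (nrm_ge0 (g z)).
move: (nrm_ge0 (f z - (f z - peval p z))).
move: (nrm (f z - peval p z)) (nrm (g z - peval q z)) (nrm (f z)) (nrm (g z)) => a b x y.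
move: (nrm _) => w w0 a0 b0 x0 y0 ha hb hx hy hw.
have : a * y <= e' * G by rewrite ler_pM.
have : w * b <= (F + 1) * e' by rewrite ler_pM //; lra.
lra.
Qed.

Lemma approxZ c f : approx f -> approx (fun z => c * f z).
Proof. by move=> hf; apply: approxM => //; exact: approx_cst. Qed.

Lemma approxB f g : approx f -> approx g -> approx (fun z => f z - g z).
Proof.
by move=> hf /(approxZ (-1)) hg; under eq_fun do rewrite -mulN1r; exact: approxD.
Qed.

(** A maximum principle: polynomials keep their bounds from [K] to its hull, hence so do their
    uniform limits. *)
Lemma approx_hull_le f M : approx f -> (forall z, K z -> nrm (f z) <= M) ->
  forall z, hull K z -> nrm (f z) <= M.
Proof.
move=> hf hM z Yz; apply/ler_addgt0Pr => e e0.
have e2 : 0 < e / 2 by rewrite divr_gt0.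
have [p hp] := hf _ e2.
rewrite -(subrK (peval p z) (f z)); apply: le_trans (le_normcD _ _) _.
rewrite addrC (splitr e) addrA lerD ?hp //; apply: Yz => w Kw.
rewrite -(subKr (f w) (peval p w)); apply: le_trans (nrmB _ _) _.
by rewrite lerD ?hM ?hp //; exact: sub_hull.
Qed.

Lemma approx_lim (s : nat -> 'cV[R[i]]_n -> R[i]) f (C : R) : (forall k, approx (s k)) ->
  (forall k z, hull K z -> nrm (f z - s k z) <= C * 2^-1 ^+ k) -> approx f.
Proof.
move=> hs hC e e0; have e2 : 0 < e / 2 by rewrite divr_gt0.
have C0 : 0 < `|C| + 1 by rewrite ltr_wpDl.
have [||k hk] := @expr_le_eps R 2^-1 (e / 2 / (`|C| + 1)).
- by rewrite invr_ge0 ler0n /= invf_lt1 ?ltr1n.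
- by rewrite divr_gt0.
have [p hp] := hs k _ e2; exists p => z Yz.
rewrite -(subrK (s k z) (f z)) -addrA (splitr e); apply: le_trans (le_normcD _ _) _.
rewrite lerD ?hp //; apply: le_trans (hC k _ Yz) _.
move: hk; rewrite ler_pdivlMr // mulrC; apply: le_trans.
rewrite ler_wpM2r ?exprn_ge0 ?invr_ge0 //.
by rewrite (le_trans (ler_norm _)) // lerDl.
Qed.

(** Partial sums of the geometric series: each step multiplies the error by [g], and the initial
    error is at most 2. *)
Lemma approx_inv1B g : approx g -> (forall z, hull K z -> nrm (g z) <= 2^-1) ->
  approx (fun z => (1 - g z)^-1).
Proof.
move=> hg g2.
have g1 z : hull K z -> 1 - g z != 0 /\ nrm (1 - g z)^-1 <= 2.
  move=> /g2 gz; have : 2^-1 <= nrm (1 - g z).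
    have := le_normcD (1 - g z) (g z); rewrite subrK Normc.normc1; move: gz.
    by move: (nrm (1 - g z)) (nrm (g z)) => a b; lra.
  move=> h; have h0 : 0 < nrm (1 - g z) by apply: lt_le_trans h; rewrite invr_gt0.
  rewrite -nrm_gt0 h0 Normc.normcV; split => //.
  by rewrite -[leRHS]invrK lef_pV2 // posrE invr_gt0.
pose s := fix s k z := if k is k'.+1 then 1 + g z * s k' z else 0.
apply: (@approx_lim s _ 2) => k.
  elim: k => [|k IH] /=; first exact: approx_cst.
  by apply: approxD; [exact: approx_cst | exact: approxM].
move=> z Yz; have [gn0 gi] := g1 _ Yz; elim: k => [|k IH] /=.
  by rewrite subr0 expr0 mulr1.
have -> : (1 - g z)^-1 - (1 + g z * s k z) = g z * ((1 - g z)^-1 - s k z) by field.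
rewrite Normc.normcM exprS mulrCA ler_pM ?nrm_ge0 ?g2 //.
Qed.

(** If [s ^+ 2 = 1 - a] with [0 <= Re s], then |1 - s| |1 + s| = |a| and |1 + s| >= 1, so
    [t = 1 - s] is no larger than [a]. *)
Lemma sqrt1B_root (a : R[i]) : nrm a <= 2^-1 ->
  exists2 t, nrm t <= 2^-1 & 2 * t = a + t ^+ 2.
Proof.
move=> ha; have [s s0 s2] : exists2 s : R[i], 0 <= Re s & s ^+ 2 = 1 - a.
  have [h|/ltW h] := leP 0 (Re (sqrtc (1 - a))).
    by exists (sqrtc (1 - a)); rewrite ?sqr_sqrtc.
  exists (- sqrtc (1 - a)); rewrite ?sqrrN ?sqr_sqrtc //.
  by move: h; case: (sqrtc _) => x y /=; rewrite oppr_ge0.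
have es : a = 1 - s ^+ 2 by rewrite s2 subKr.
exists (1 - s); last by rewrite es; ring.
have : nrm (1 - s) * nrm (1 + s) <= 2^-1.
  by rewrite -Normc.normcM; have <- : a = (1 - s) * (1 + s) by (rewrite es; ring).
apply: le_trans; rewrite -[leLHS]mulr1 ler_wpM2l ?nrm_ge0 //.
apply: le_trans (normr_Re_le_nrm _); case: s s0 {s2 es} => x y /= x0.
by rewrite ger0_norm ?addr_ge0 // lerDl.
Qed.

(* Writing the root as [1 - t], [t] is the limit of [t <- (g + t^2) / 2]. *)
Lemma approx_sqrt1B g : approx g -> (forall z, hull K z -> nrm (g z) <= 2^-1) ->
  exists2 s, approx s & forall z, hull K z -> s z ^+ 2 = 1 - g z /\ 0 < Re (s z).
Proof.
move=> hg g2.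
have /choice[t ht] : forall z, exists t, hull K z -> nrm t <= 2^-1 /\ 2 * t = g z + t ^+ 2.
  move=> z; have [Yz|Yz] := pselect (hull K z); last by exists 0.
  by have [t t2 te] := sqrt1B_root (g2 _ Yz); exists t.
pose s := fix s k z := if k is k'.+1 then 2^-1 * (g z + s k' z * s k' z) else 0.
have n2 : nrm (2^-1 : R[i]) = 2^-1.
  by rewrite Normc.normcV; have := nrm_real (2 : R); rewrite rmorph_nat ger0_norm // => ->.
have s2 k z : hull K z -> nrm (s k z) <= 2^-1.
  move=> Yz; elim: k => [|k IH]; first by rewrite Normc.normc0 invr_ge0.
  rewrite [s _ _]/= Normc.normcM n2; apply: le_trans (ler_wpM2l _ (le_normcD _ _)) _; first by rewrite invr_ge0.
  rewrite Normc.normcM; have := g2 _ Yz; have := nrm_ge0 (s k z); nra.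
have at_ : approx t.
  apply: (@approx_lim s _ 2^-1) => k.
    elim: k => [|k IH] /=; first exact: approx_cst.
    by apply/approxZ/approxD => //; exact: approxM.
  move=> z Yz; have [t2 te] := ht _ Yz; elim: k => [|k IH] /=; first by rewrite subr0 mulr1.
  (* The factor [t z + s k z] has norm at most 1, so each iteration halves the error. *)
  have -> : t z - 2^-1 * (g z + s k z * s k z) = 2^-1 * ((t z + s k z) * (t z - s k z)).
    have -> : g z = 2 * t z - t z ^+ 2 by rewrite te addrK.
    by field.
  rewrite Normc.normcM n2 exprS mulrCA ler_wpM2l ?invr_ge0 // Normc.normcM.
  apply: le_trans IH; rewrite -[leRHS]mul1r ler_wpM2r ?nrm_ge0 //.
  apply: le_trans (le_normcD _ _) _; have := s2 k _ Yz; lra.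
exists (fun z => 1 - t z); first by apply: approxB => //; exact: approx_cst.
move=> z Yz; have [t2 te] := ht _ Yz; split.
  have -> : g z = 2 * t z - t z ^+ 2 by rewrite te addrK.
  by ring.
have := le_trans (normr_Re_le_nrm _) t2; case: (t z) => x y /= hx.
have := ler_norm x; lra.
Qed.
End UniformClosure.

(* Keeps track of the branch: when [a^2] moves horizontally, the continuation
   [a * s] of its root cannot cross the imaginary axis. *)
Lemma Re_mul_gt0 (R : realType) (a s : R[i]) :
  0 < Re a -> 0 < Re s -> Im (a ^+ 2) = Im ((a * s) ^+ 2) -> 0 < Re (a * s).
Proof.
case: a s => [x y] [p q] /= x0 p0 h; rewrite ltNge; apply/negP => h0.
set X := x * p - y * q in h h0; set Y := x * q + y * p in h.
have xy : x * y = X * Y by move: h; lra.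
(* The real part of [conjc a * (a * s)]; it is positive, whereas [X <= 0] would make both terms on
   the left nonpositive. *)
have e : x * X + y * Y = (x ^+ 2 + y ^+ 2) * p by rewrite /X /Y; ring.
have : 0 < (x ^+ 2 + y ^+ 2) * p by rewrite mulr_gt0 // ltr_wpDr ?sqr_ge0 // exprn_gt0.
have : x * (y * Y) <= 0.
  have -> : x * (y * Y) = X * Y ^+ 2 by rewrite mulrA xy; ring.
  by rewrite mulr_le0_ge0 // sqr_ge0.
rewrite pmulr_rle0 // -e => yY; have : x * X <= 0 by rewrite pmulr_rle0.
lra.
Qed.

(** * Pole pushing *)

Section PolePushing.
Variables (R : realType) (n : nat) (K : set 'cV[R[i]]_n).
Hypothesis bK : coord_bounded K.
Variable u : 'cV[R[i]]_n -> R[i].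
Hypothesis au : approx K u.

(** The inverse [f] and the root [A] of [c - u] travel together: [f] gives the correction when the
    pole moves, and the sign of [Re (A z)] fixes the branch on [K]. *)
Definition resolvent_sqrt (c : R[i]) := exists f A : 'cV[R[i]]_n -> R[i],
  [/\ approx K f, approx K A, forall z, hull K z -> f z * (c - u z) = 1,
      forall z, hull K z -> A z ^+ 2 = c - u z & forall z, K z -> 0 < Re (A z)].

(** Far to the right, [c - u] is [Re c] times a factor within 1/2 of 1. *)
Lemma resolvent_sqrt_large (M : R) (c : R[i]) : (forall z, K z -> nrm (u z) <= M) ->
  0 < Re c -> 2 * (M + `|Im c|) <= Re c -> resolvent_sqrt c.
Proof.
move=> hM; set N := Re c => N0 hN.
have Nn : N%:C != 0 by rewrite -nrm_gt0 nrm_real normr_gt0 gt_eqF.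
pose g z := N%:C^-1 * (u z - (c - N%:C)).
have ag : approx K g by apply/approxZ/approxB => //; exact: approx_cst.
have cg z : c - u z = N%:C * (1 - g z) by rewrite /g; field.
have g2 : forall z, hull K z -> nrm (g z) <= 2^-1.
  apply: approx_hull_le => // z Kz.
  rewrite /g Normc.normcM Normc.normcV nrm_real gtr0_norm // mulrC ler_pdivrMr //.
  apply: le_trans (nrmB _ _) _; have := hM _ Kz.
  have -> : nrm (c - N%:C) = `|Im c|.
    by rewrite /N; case: (c) => x y /=; rewrite subrr oppr0 addr0 expr0n add0r sqrtr_sqr.
  by lra.
have [s as_ hs] := approx_sqrt1B bK ag g2.
exists (fun z => N%:C^-1 * (1 - g z)^-1), (fun z => (Num.sqrt N)%:C * s z); split.
- by apply: approxZ => //; exact: approx_inv1B.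
- exact: approxZ.
- move=> z Yz; rewrite cg; have : 1 - g z != 0.
    by have [<- h] := hs _ Yz; rewrite sqrf_eq0; apply: contraTneq h => ->; rewrite ltxx.
  by move=> ?; field; apply/andP.
- move=> z Yz; rewrite cg; have [<- _] := hs _ Yz; rewrite exprMn; congr (_ * _).
  by rewrite -rmorphXn /= sqr_sqrtr // ltW.
- move=> z Kz; have [_] := hs _ (sub_hull Kz); case: (s z) => x y /= x0.
  by rewrite mul0r subr0 mulr_gt0 // sqrtr_gt0.
Qed.

(** Here [c - u = (c + r - u) * (1 - r * f)] with |r f| <= 1/2, so both functions at [c + r] only
    get a correcting factor. As the shift is real, [Re_mul_gt0] preserves the branch. *)
Lemma resolvent_sqrt_step (r : R) (c : R[i]) :
  (forall z, K z -> 2 * `|r| <= nrm (c + r%:C - u z)) ->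
  resolvent_sqrt (c + r%:C) -> resolvent_sqrt c.
Proof.
move=> hr [f [A [af aA fE AE A0]]].
pose g z := r%:C * f z.
have ag : approx K g by exact: approxZ.
have g2 : forall z, hull K z -> nrm (g z) <= 2^-1.
  apply: approx_hull_le => // z Kz; have := hr _ Kz.
  have := congr1 (@Normc.normc R) (fE _ (sub_hull Kz)); rewrite Normc.normcM Normc.normc1.
  rewrite /g Normc.normcM nrm_real; have := nrm_ge0 (f z); have := normr_ge0 r.
  by move: (nrm _) (nrm _) `|r| => x y w; nra.
have [s as_ hs] := approx_sqrt1B bK ag g2.
have cg z : hull K z -> c - u z = (c + r%:C - u z) * (1 - g z).
  by move=> Yz; rewrite mulrBr mulr1 /g mulrCA [_ * f z]mulrC (fE _ Yz); ring.
exists (fun z => f z * (1 - g z)^-1), (fun z => A z * s z); split.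
- by apply: approxM => //; exact: approx_inv1B.
- exact: approxM.
- move=> z Yz; rewrite cg // mulrACA fE // mul1r mulVf //.
  by have [<- h] := hs _ Yz; rewrite sqrf_eq0; apply: contraTneq h => ->; rewrite ltxx.
- by move=> z Yz; rewrite cg // exprMn AE //; have [-> _] := hs _ Yz.
- move=> z Kz; have Yz := sub_hull Kz; have [s2 s0] := hs _ Yz.
  apply: Re_mul_gt0 => //; first exact: A0.
  rewrite exprMn AE // s2 -cg //; case: (c) (u z) => [x y] [x' y'] /=.
  by rewrite addr0.
Qed.

(** The pole starts far to the right on the ray and comes back to [c] in finitely many steps of
    length [e / 2]. *)
Lemma resolvent_sqrt_ray (e : R) (c : R[i]) : 0 < e ->
  (forall z (t : R), K z -> 0 <= t -> e <= nrm (c + t%:C - u z)) -> resolvent_sqrt c.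
Proof.
move=> e0 he; have [M M0 hM] := approx_bounded bK au.
have hMK z : K z -> nrm (u z) <= M by move=> Kz; exact: hM (sub_hull Kz).
pose T := 2 * (M + `|Im c|) + 1 - Re c.
have [m hm] : exists m : nat, T <= m%:R * (e / 2).
  exists (Num.bound (`|T| / (e / 2))).
  rewrite -ler_pdivrMr ?divr_gt0 //; apply: le_trans (ltW (archi_boundP _)).
    by rewrite ler_wpM2r ?invr_ge0 ?ler_norm // ltW ?divr_gt0.
  by rewrite divr_ge0 // ltW ?divr_gt0.
rewrite {}/T in hm; elim: m c he hm => [|m IH] c he hm.
  have := normr_ge0 (Im c); move: hm; rewrite mul0r => h h'.
  by apply: (@resolvent_sqrt_large M) => //; lra.
apply: (@resolvent_sqrt_step (e / 2)).
  move=> z Kz; rewrite ger0_norm; last by rewrite divr_ge0 // ltW.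
  have -> : 2 * (e / 2) = e by field.
  by apply: he => //; rewrite divr_ge0 // ltW.
apply: IH.
  move=> z t Kz t0; rewrite -[_ + t%:C]addrA -(rmorphD (real_complex R)); apply: he => //.
  by rewrite addr_ge0 // divr_ge0 // ltW.
move: hm; rewrite -natr1; case: (c) => x y /=; rewrite addr0; lra.
Qed.
End PolePushing.

(* [G] is multiplied by a high power of [q]. *)
Lemma hull_damping (R : realType) (n : nat) (K : set 'cV[R[i]]_n) (E : set 'cV[R[i]]_n)
    (q : mpoly.mpoly n R[i]) (z0 : 'cV[R[i]]_n) (r B e : R) :
  coord_bounded K -> hull K z0 -> nrm (peval q z0) = 1 -> 0 <= r < 1 ->
  (forall z, K z -> nrm (peval q z) <= r \/ E z) -> 0 < e ->
  exists2 d, 0 < d & forall G, approx K G ->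
    (forall z, K z -> nrm (peval q z) <= r -> nrm (G z) <= B) ->
    (forall z, K z -> E z -> nrm (G z) <= d) -> nrm (G z0) <= e.
Proof.
move=> bK Yz0 q1 r01 KE e0; have [C C0 hC] := peval_bounded q bK.
have B0 : 0 < `|B| + 1 by rewrite ltr_wpDl.
have [N] := expr_le_eps r01 (divr_gt0 e0 B0); rewrite ler_pdivlMr // => hN.
have CN : 0 < C ^+ N + 1 by rewrite ltr_wpDl // exprn_ge0.
(* [N] beats [B] where [q] is small; [d] absorbs the growth of [q ^+ N] on [E] and does not depend
   on [G]. *)
exists (e / (C ^+ N + 1)); first exact: divr_gt0.
move=> G aG GB Gd.
suff : nrm (G z0 * peval (q ^+ N) z0) <= e.
  by rewrite Normc.normcM pevalXn nrmX q1 expr1n mulr1.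
have aGq := approxM bK aG (approx_peval K (q ^+ N)).
apply: (approx_hull_le aGq) => // z Kz; rewrite Normc.normcM pevalXn nrmX.
case: (KE _ Kz) => [qr|Ez].
  apply: le_trans hN; rewrite mulrC; apply: ler_pM; rewrite ?exprn_ge0 ?nrm_ge0 //.
    by case/andP: r01 => r0 _; rewrite lerXn2r ?nnegrE ?nrm_ge0.
  by apply: le_trans (GB _ Kz qr) _; rewrite (le_trans (ler_norm _)) // lerDl.
apply: (@le_trans _ _ (e / (C ^+ N + 1) * C ^+ N)).
  apply: ler_pM; rewrite ?exprn_ge0 ?nrm_ge0 ?Gd //.
  by rewrite lerXn2r ?nnegrE ?nrm_ge0 ?hC.
by rewrite mulrAC ler_pdivrMr // ler_wpM2l ?lerDl // ltW.
Qed.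

(** Otherwise [(y - (1 + w) * x) * (y + x)] would be positive. With [x = Re a] and [y] = |Im a|,
    this bounds the argument of [a] through that of [a ^+ 2]. *)
Lemma sqr_sub_le (R : realType) (x y w : R) : 0 < x -> 0 <= w ->
  y ^+ 2 - x ^+ 2 <= w * (x * y) -> y <= (1 + w) * x.
Proof.
move=> x0 w0 h; rewrite leNgt; apply/negP => h'.
have y0 : 0 < y by apply: lt_trans _ h'; rewrite mulr_gt0 //; lra.
have p1 : 0 < (y - (1 + w) * x) * (y + x) by rewrite mulr_gt0 ?subr_gt0 ?addr_gt0.
have p2 : 0 <= w * (x * x) by rewrite !mulr_ge0 // ltW.
by nra.
Qed.

(** * Kallin's lemma *)

Section SquareRoots.
Variable R : realType.
Implicit Types (a b c v : R[i]).

Lemma mul_conjc a : a * conjc a = (nrm a ^+ 2)%:C.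
Proof. by rewrite sqr_nrm; case: a => x y; apply/eqP; rewrite eq_complex /=; apply/andP; split; apply/eqP; ring. Qed.

(** The roots have conjugate squares and positive real parts, so [b = conjc a] and [a * b] is |c -
    v|, at distance at most |c| from [v]. *)
Lemma sqrt_pair_real a b c v : a ^+ 2 = c - v -> b ^+ 2 = conjc c - v ->
  0 < Re a -> 0 < Re b -> Im v = 0 -> 0 <= Re v -> nrm (v - a * b) <= nrm c.
Proof.
move=> ha hb a0 b0 v0 v1.
have vE : v = (Re v)%:C by move: v0; case: (v) => x y /= ->.
have vJ : conjc v = v by rewrite vE conjc_real.
have bE : b = conjc a.
  have : (b - conjc a) * (b + conjc a) = 0.
    by rewrite -subr_sqr hb -rmorphXn /= ha rmorphB /= vJ subrr.
  move/eqP; rewrite mulf_eq0 subr_eq0 => /orP[/eqP //|/eqP h].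
  suff : 0 < Re (b + conjc a) by rewrite h /= ltxx.
  by move: a0 b0; case: (a) (b) => [x y] [x' y'] /= ? ?; rewrite addr_gt0.
rewrite bE mul_conjc -nrmX ha [X in nrm (X - _)]vE -rmorphB nrm_real.
have nv : nrm v = Re v by rewrite vE nrm_real ger0_norm.
rewrite ler_norml; have h1 := nrmB c v; have h2 := nrmB c (c - v).
rewrite subKr in h2; rewrite nv in h1 h2.
by move: (nrm (c - v)) (nrm c) h1 h2 => x y; lra.
Qed.

(* Since [a^2 - b^2 = c - conjc c], [v + a b = c - (c - conjc c) a / (a + b)]. *)
Lemma sqrt_pair_cone a b c v (k : R) : a ^+ 2 = c - v -> b ^+ 2 = conjc c - v ->
  0 < Re a -> 0 < Re b -> 0 < k -> k * Re (v - c) <= `|Im (v - c)| ->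
  nrm (v + a * b) <= nrm c + 2 * `|Im c| * (2 + 2 / k).
Proof.
move=> ha hb a0 b0 k0 hv.
(* As [v - c], the opposite of [a ^+ 2], avoids the sector, the argument of [a] stays away from pi/2
   and -pi/2. *)
have aRe : nrm a <= (2 + 2 / k) * Re a.
  apply: le_trans (nrm_le_ReIm _) _; rewrite (gtr0_norm a0).
  suff : `|Im a| <= (1 + 2 / k) * Re a by lra.
  have : k * (Im a ^+ 2 - Re a ^+ 2) <= 2 * (Re a * `|Im a|).
    have vc : v - c = - (a ^+ 2) by rewrite ha opprB.
    move: hv; rewrite vc; case: (a) a0 => x y /= x0.
    have -> : `|- (x * y + y * x)| = 2 * (x * `|y|).
      by rewrite normrN [y * x]mulrC -mulr2n normrMn normrM (gtr0_norm x0) mulr_natl.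
    by lra.
  rewrite -[Im a ^+ 2]real_normK ?num_real // => h; apply: sqr_sub_le => //.
    by rewrite divr_ge0 // ltW.
  rewrite -(ler_pM2l k0); apply: le_trans h _.
  by rewrite [leRHS]mulrA [k * (2 / k)]mulrCA divff ?gt_eqF // mulr1.
have ab0 : 0 < Re (a + b) by move: a0 b0; case: (a) (b) => [x y] [x' y'] /= ? ?; rewrite addr_gt0.
have abn : Re a <= nrm (a + b).
  apply: le_trans (normr_Re_le_nrm _); rewrite gtr0_norm //.
  by move: b0; case: (a) (b) => [x y] [x' y'] /= ?; rewrite lerDl ltW.
have ab1 : a + b != 0 by apply: contraTneq ab0 => ->; rewrite ltxx.
have -> : v + a * b = c - (c - conjc c) * (a / (a + b)).
  have -> : c - conjc c = (a - b) * (a + b) by rewrite -subr_sqr ha hb; ring.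
  have -> : c = a ^+ 2 + v by rewrite ha subrK.
  by field.
apply: le_trans (nrmB _ _) _; rewrite lerD2l Normc.normcM; apply: ler_pM; rewrite ?nrm_ge0 //.
  apply: le_trans (nrm_le_ReIm _) _; case: (c) => x y /=.
  by rewrite subrr normr0 add0r opprK -mulr2n normrMn mulr_natl.
rewrite Normc.normcM Normc.normcV ler_pdivrMr ?nrm_gt0 //.
apply: le_trans aRe _; rewrite ler_wpM2l //; first by rewrite addr_ge0 // divr_ge0 // ltW.
Qed.

Lemma nrm_ge_cone (k e : R) v : 0 < k -> e <= `|Im v| + k * `|Re v| -> e / (1 + k) <= nrm v.
Proof.
move=> k0 he; rewrite ler_pdivrMr ?addr_gt0 //; apply: le_trans he _.
have := normr_Re_le_nrm v; have := normr_Im_le_nrm v.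
by move: (nrm v) `|Re v| `|Im v| => x y z; nra.
Qed.
End SquareRoots.

Section Kallin.
Variables (R : realType) (n : nat) (K : set 'cV[R[i]]_n).
Hypothesis bK : coord_bounded K.
Variables (u : mpoly.mpoly n R[i]) (k : R) (Ka Kb : set 'cV[R[i]]_n).
Hypotheses (k0 : 0 < k) (KE : K = Ka `|` Kb).
Hypothesis uKa : forall z, Ka z -> Im (peval u z) = 0 /\ 0 <= Re (peval u z).
Hypothesis uKb : forall z, Kb z -> k * Re (peval u z) <= `|Im (peval u z)|.

(** [c] lies half-way up the sector of slope [k]. The ray from [c] keeps its height over the
    half-line containing [u] on [Ka], and stays inside the sector that [u] avoids on [Kb]. *)
Lemma cone_shift (h t : R) (c : R[i]) z : 0 <= t -> Re c = h -> `|Im c| = k * h / 2 ->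
  K z -> k * h / 2 <= `|Im (c + t%:C - peval u z)| + k * `|Re (c + t%:C - peval u z)|.
Proof.
rewrite KE => t0 ch ci [/uKa[]|/uKb].
  move=> im _; have -> : Im (c + t%:C - peval u z) = Im c.
    by move: im; case: (c) (peval u z) => [x y] [x' y'] /= ->; rewrite addr0 subr0.
  by rewrite ci lerDl mulr_ge0 // ltW.
move: ch ci; case: (c) (peval u z) => [x y] [x' y'] /= -> ci hv.
have := ler_norm (h + t - x'); have := lerB_dist y' y; rewrite distrC addr0 ci.
move=> h1 /(ler_wpM2l (ltW k0)); have := mulr_ge0 (ltW k0) t0; move: h1 hv.
by move: `|h + t - x'| `|y - y'| `|y'| => a b d; lra.
Qed.

Lemma resolvent_sqrt_cone (h : R) (c : R[i]) : 0 < h -> Re c = h -> `|Im c| = k * h / 2 ->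
  resolvent_sqrt K (peval u) c.
Proof.
move=> h0 ch ci; apply: (@resolvent_sqrt_ray _ _ _ bK _ (approx_peval K u) (k * h / 2 / (1 + k))).
  by rewrite !divr_gt0 ?mulr_gt0 ?addr_gt0.
by move=> z t Kz t0; apply: nrm_ge_cone => //; exact: cone_shift.
Qed.

Lemma sign_function (h : R) : 0 < h -> exists2 S, approx K S &
  (forall z, Ka z -> nrm (peval u z - S z) <= h * (4 + 4 * k)) /\
  (forall z, Kb z -> nrm (peval u z + S z) <= h * (4 + 4 * k)).
Proof.
move=> h0; pose c : R[i] := h +i* (k * h / 2).
have e0 : 0 < k * h / 2 by rewrite divr_gt0 ?mulr_gt0.
have cn : nrm c <= h * (4 + 4 * k).
  by apply: le_trans (nrm_le_ReIm _) _; rewrite /= !gtr0_norm //; nra.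
have [|f [A [af aA fE AE A0]]] := @resolvent_sqrt_cone h c h0 erefl; first by rewrite gtr0_norm.
have [|f' [A' [af' aA' fE' AE' A0']]] := @resolvent_sqrt_cone h (conjc c) h0 erefl.
  by rewrite /= normrN gtr0_norm.
exists (fun z => A z * A' z); first exact: approxM.
split => z Kz; have Kz' : K z by [rewrite KE; left | rewrite KE; right].
  have Yz := sub_hull Kz'; have [u1 u2] := uKa Kz.
  by apply: le_trans cn; apply: sqrt_pair_real; rewrite ?AE ?AE' ?A0 ?A0'.
have Yz := sub_hull Kz'.
(* As |Im c| = k h / 2, this is at most h + k h / 2 + 2 k h + 2 h, whence the constant
   [4 + 4 * k]. *)
apply: (@le_trans _ _ (nrm c + 2 * `|Im c| * (2 + 2 / k))).
  apply: sqrt_pair_cone; rewrite ?AE ?AE' ?A0 ?A0' //.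
  move: (uKb Kz); rewrite /c; case: (peval u z) => x y /=.
  have := lerB_dist y (k * h / 2); rewrite (gtr0_norm e0).
  by move: `|y - k * h / 2| `|y| => a b; nra.
apply: le_trans (lerD (nrm_le_ReIm _) (lexx _)) _.
rewrite /= !gtr0_norm //.
have -> : 2 * (k * h / 2) * (2 + 2 / k) = 2 * k * h + 2 * h by field; rewrite gt_eqF.
by have := mulr_gt0 k0 h0; lra.
Qed.

(** If [z0] were in neither hull, damping by [qa] would make [u + S] small at [z0], and damping by
    [qb] would make [u - S] small there; but their sum is twice the nonzero value of [u]. *)
Lemma kallin z0 : Ka !=set0 -> Kb !=set0 -> hull K z0 -> peval u z0 != 0 ->
  hull Ka z0 \/ hull Kb z0.
Proof.
move=> Ka0 Kb0 Yz0 u0; apply: contrapT => /not_orP[/(notin_hull Ka0)[qa qa1 qaK]].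
move=> /(notin_hull Kb0)[qb qb1 qbK].
have [M M0 hM] := peval_bounded u bK.
have r01 : 0 <= (2^-1 : R) < 1 by rewrite invr_ge0 ler0n /= invf_lt1 ?ltr1n.
have D0 : 0 < 4 + 4 * k by rewrite addr_gt0 ?mulr_gt0.
(* Bounds [u + S] and [u - S] on [K] for all [h <= 1]: one of them is small, and the other is
   [2 * u] minus it. *)
pose B := 2 * M + (4 + 4 * k).
have e0 : 0 < nrm (peval u z0) / 2 by rewrite divr_gt0 // nrm_gt0.
have Ea z : K z -> nrm (peval qa z) <= 2^-1 \/ Kb z by rewrite KE => -[/qaK|]; [left|right].
have Eb z : K z -> nrm (peval qb z) <= 2^-1 \/ Ka z by rewrite KE => -[|/qbK]; [right|left].
have [da da0 hda] := hull_damping B bK Yz0 qa1 r01 Ea e0.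
have [db db0 hdb] := hull_damping B bK Yz0 qb1 r01 Eb e0.
pose h := Num.min 1 (Num.min da db / (4 + 4 * k)).
have h0 : 0 < h by rewrite lt_min ltr01 divr_gt0 // lt_min da0.
have hd : h * (4 + 4 * k) <= Num.min da db by rewrite -ler_pdivlMr // ge_min lexx orbT.
have hda' : h * (4 + 4 * k) <= da by apply: le_trans hd _; rewrite ge_min lexx.
have hdb' : h * (4 + 4 * k) <= db by apply: le_trans hd _; rewrite ge_min lexx orbT.
have h4 : h * (4 + 4 * k) <= 4 + 4 * k by rewrite ler_piMl ?(ltW D0) // ge_min lexx.
have [S aS [Sa Sb]] := sign_function h0.
have au := approx_peval K u.
have M2 z : K z -> nrm (2 * peval u z) <= 2 * M.
  by move=> Kz; rewrite mulr_natl normcMn -[leLHS]mulr_natl ler_wpM2l ?hM.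
have GB z : K z -> nrm (peval u z + S z) <= B /\ nrm (peval u z - S z) <= B.
  move=> Kz; have h2 := M2 _ Kz; move: Kz; rewrite KE => -[/Sa|/Sb] hz.
    split; last by rewrite /B ler_wpDl ?mulr_ge0 // (le_trans hz).
    have -> : peval u z + S z = 2 * peval u z - (peval u z - S z) by ring.
    by apply: le_trans (nrmB _ _) _; rewrite lerD // (le_trans hz).
  split; first by rewrite /B ler_wpDl ?mulr_ge0 // (le_trans hz).
  have -> : peval u z - S z = 2 * peval u z - (peval u z + S z) by ring.
  by apply: le_trans (nrmB _ _) _; rewrite lerD // (le_trans hz).
have g1 : nrm (peval u z0 + S z0) <= nrm (peval u z0) / 2.
  apply: (hda (fun z => peval u z + S z)); first exact: approxD.
    by move=> z /GB[].
  by move=> z _ /Sb /le_trans; exact.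
have g2 : nrm (peval u z0 - S z0) <= nrm (peval u z0) / 2.
  apply: (hdb (fun z => peval u z - S z)); first exact: approxB.
    by move=> z /GB[].
  by move=> z _ /Sa /le_trans; exact.
have := le_normcD (peval u z0 + S z0) (peval u z0 - S z0).
have -> : peval u z0 + S z0 + (peval u z0 - S z0) = peval u z0 *+ 2 by rewrite mulr2n; ring.
rewrite normcMn mulr2n; move: e0 g1 g2.
by move: (nrm (peval u z0)) (nrm _) (nrm _) => x y w *; lra.
Qed.

(** A polynomial [q] small on [Kc] is still small on [E] near 0, by continuity; on the rest of [E],
    where |u| is bounded below, [c / (c - u)] is small, although it equals 1 at [z0]. *)
Lemma kallin_zero_fiber z0 (Kc E : set 'cV[R[i]]_n) : Kc !=set0 -> (forall z, K z -> Kc z \/ E z) ->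
  (forall d : R, 0 < d -> exists2 m : R, 0 < m & forall z, E z ->
    (exists j, d < nrm (z j 0)) -> m <= nrm (peval u z)) ->
  Kc 0 -> hull K z0 -> peval u z0 = 0 -> hull Kc z0.
Proof.
move=> Kc0 KcE hE Kc00 Yz0 u0; apply: contrapT => /(notin_hull Kc0)[q q1 qK].
have e4 : 0 < (4^-1 : R) by rewrite invr_gt0.
have [d d0 hd] := peval_continuous0 q e4.
have [m m0 hm] := hE _ d0.
(* The bound 1/2 of [q] at 0, a point of [Kc], plus the oscillation 1/4 of [q] near 0. *)
have r01 : 0 <= (3 / 4 : R) < 1 by apply/andP; split; lra.
have KE' z : K z -> nrm (peval q z) <= 3 / 4 \/ m <= nrm (peval u z).
  case/KcE=> [/qK h|Ez]; first by left; apply: le_trans h _; lra.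
  have [zd|zd] := pselect (exists j, d < nrm (z j 0)); first by right; exact: hm.
  left; rewrite -(subrK (peval q 0) (peval q z)); apply: le_trans (le_normcD _ _) _.
  have -> : 3 / 4 = 4^-1 + 2^-1 :> R by field.
  apply: lerD; last exact: qK.
  by apply: hd => j; rewrite leNgt; apply/negP => h; apply: zd; exists j.
have h2 : 0 < (2^-1 : R) by rewrite invr_gt0.
have k1 : 0 < 1 + k by rewrite addr_gt0.
(* Bounds [c / (c - u)] on [K] whatever [h], since |c| <= h (2 + k) and |c - u| >= (k h / 2) / (1 +
   k). *)
pose B := (2 + k) * (1 + k) * 2 / k.
have [e e0 he] := @hull_damping _ _ _ [set z | m <= nrm (peval u z)] q z0 (3 / 4) B 2^-1
  bK Yz0 q1 r01 KE' h2.
(* This [h] gives |c| <= e (m - |c|), hence |c / (c - u)| <= e where |u| >= m. *)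
have [h h0 hek] : exists2 h, 0 < h & h * (2 + k) * (1 + e) = e * m.
  exists (e * m / ((1 + e) * (2 + k))); first by rewrite !(divr_gt0, mulr_gt0, addr_gt0).
  by field; rewrite !gt_eqF // addr_gt0.
pose c : R[i] := h +i* (k * h / 2).
have e'0 : 0 < k * h / 2 by rewrite divr_gt0 ?mulr_gt0.
have cn : nrm c <= h * (2 + k).
  by apply: le_trans (nrm_le_ReIm _) _; rewrite /= !gtr0_norm //; nra.
have [|f [A [af _ fE _ _]]] := @resolvent_sqrt_cone h c h0 erefl; first by rewrite gtr0_norm.
have f0 : c * f z0 = 1 by have := fE _ Yz0; rewrite u0 subr0 mulrC.
have cf z (r : R) : K z -> nrm c <= r * nrm (c - peval u z) -> nrm (c * f z) <= r.
  move=> Kz hr; rewrite Normc.normcM; apply: le_trans (ler_wpM2r (nrm_ge0 _) hr) _.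
  by rewrite -mulrA -Normc.normcM [_ * f z]mulrC fE ?Normc.normc1 ?mulr1 //; exact: sub_hull.
have : nrm (c * f z0) <= 2^-1.
  apply: (he (fun z => c * f z)); first exact: approxZ.
    move=> z Kz _; apply: cf => //; apply: le_trans cn _.
    have : k * h / 2 / (1 + k) <= nrm (c - peval u z).
      apply: nrm_ge_cone => //; have := @cone_shift h 0 c z (lexx _) erefl.
      by rewrite addr0; apply=> //=; rewrite gtr0_norm.
    have B0 : 0 <= B by rewrite /B !mulr_ge0 ?addr_ge0 ?invr_ge0 // ltW.
    move=> /(ler_wpM2l B0); apply: le_trans.
    by have -> : B * (k * h / 2 / (1 + k)) = h * (2 + k) by rewrite /B; field; rewrite !gt_eqF.
  move=> z Kz /= mz; have ecn := ler_wpM2l (ltW e0) cn.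
  apply: cf => //; apply: le_trans cn _.
  have := nrmB c (c - peval u z); rewrite subKr => /(le_trans mz).
  move/(ler_wpM2l (ltW e0)); move: ecn hek.
  by move: (nrm c) (nrm _) => x y; lra.
by rewrite f0 Normc.normc1; lra.
Qed.
End Kallin.

(** * Euclidean balls and localization at the origin *)

Lemma nrm_coord_le_enorm (R : realType) (n : nat) (z : 'cV[R[i]]_n) k : nrm (z k 0) <= enorm z.
Proof.
rewrite /enorm -[leLHS]ger0_norm ?nrm_ge0 // -sqrtr_sqr ler_wsqrtr //.
by rewrite (bigD1 k) //= lerDl sumr_ge0 // => j _; rewrite sqr_ge0.
Qed.

Lemma enorm_le_sqr (R : realType) (n : nat) (z : 'cV[R[i]]_n) (r : R) : 0 <= r ->
  (enorm z <= r) = (\sum_(k < n) nrm (z k 0) ^+ 2 <= r ^+ 2).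
Proof.
move=> r0; rewrite -{1}[r]ger0_norm // -sqrtr_sqr ler_sqrt ?sqr_ge0 //.
Qed.

Lemma nrm_sum (R : realType) (I : Type) (s : seq I) (F : I -> R[i]) :
  nrm (\sum_(k <- s) F k) <= \sum_(k <- s) nrm (F k).
Proof.
elim: s => [|k s IH]; first by rewrite !big_nil Normc.normc0.
by rewrite !big_cons; apply: le_trans (le_normcD _ _) _; rewrite lerD2l.
Qed.

(* A point [z] of the hull is tested on the polynomial [<., z>]. *)
Lemma hull_ball (R : realType) (n : nat) (r : R) : 0 <= r ->
  hull (eclosed_ball (0 : 'cV[R[i]]_n) r) `<=` eclosed_ball 0 r.
Proof.
move=> r0 z hz; rewrite /eclosed_ball /= subr0 enorm_le_sqr //.
set E := \sum_(k < n) _.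
have E0 : 0 <= E by rewrite sumr_ge0 // => k _; rewrite sqr_ge0.
pose q : mpoly.mpoly n R[i] :=
  \sum_(k < n) mpoly.mpolyC n (conjc (z k 0)) * mpoly.mpolyX R[i] (mpoly.mnm1 k).
have qE w : peval q w = \sum_(k < n) conjc (z k 0) * w k 0.
  rewrite /peval /q raddf_sum /=; apply: eq_bigr => k _.
  by rewrite mpoly.mevalM mpoly.mevalC mpoly.mevalXU.
have qz : peval q z = E%:C.
  rewrite qE rmorph_sum /=; apply: eq_bigr => k _.
  by rewrite mulrC mul_conjc.
(* The mean inequality bounds |<w, z>| on the ball; at [z] itself it reads E <= (E + r^2) / 2, so E
   <= r^2. *)
have : nrm (peval q z) <= (E + r ^+ 2) / 2.
  apply: hz => w; rewrite /eclosed_ball /= subr0 enorm_le_sqr // => wr.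
  rewrite qE; apply: le_trans (nrm_sum _ _) _.
  apply: (@le_trans _ _ ((E + \sum_(k < n) nrm (w k 0) ^+ 2) / 2)); last by lra.
  rewrite /E -big_split /= mulr_suml ler_sum // => k _.
  have -> : nrm (conjc (z k 0) * w k 0) = nrm (z k 0) * nrm (w k 0).
    by rewrite Normc.normcM; congr (_ * _); case: (z k 0) => x y /=; rewrite sqrrN.
  have := sqr_ge0 (nrm (z k 0) - nrm (w k 0)); lra.
by rewrite qz nrm_real ger0_norm //; lra.
Qed.

Lemma eclosed_ball0 (R : realType) (n : nat) (r : R) : 0 <= r ->
  eclosed_ball (0 : 'cV[R[i]]_n) r 0.
Proof.
move=> r0; rewrite /eclosed_ball /= subr0 enorm_le_sqr // big1 ?sqr_ge0 //.
by move=> k _; rewrite mxE Normc.normc0 expr0n.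
Qed.

(** By monotonicity of hulls, the radius serves all smaller pieces, so one radius can be shared by
    several unions. *)
Lemma lpc_hull (R : realType) (n : nat) (E : set 'cV[R[i]]_n) :
  E 0 -> locally_polynomially_convex_at E 0 ->
  exists2 r : R, 0 < r & forall S : set 'cV[R[i]]_n, S `<=` E `&` eclosed_ball 0 r -> hull S `<=` E.
Proof.
move=> E0 [r r0 Er]; exists r => // S SE z hz.
have : hull (E `&` eclosed_ball 0 r) z by exact: hull_mono hz.
have K0 : (E `&` eclosed_ball 0 r) !=set0.
  by exists 0; split => //; exact/eclosed_ball0/ltW.
by rewrite -(polynomial_hullE K0) Er => -[].
Qed.

(** * Real binary quadratic forms *)

Section Forms.
Variable R : realType.

(** Completing squares: 4 a times the form is a square plus [D * y ^+ 2], and 4 c times the form is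
    a square plus [D * x ^+ 2]. *)
Lemma definite_form_bound (a b c : R) : 0 < 4 * a * c - b ^+ 2 ->
  exists2 k, 0 < k & forall x y, k * (x ^+ 2 + y ^+ 2) <= `|a * x ^+ 2 + b * (x * y) + c * y ^+ 2|.
Proof.
set D := _ - _ => D0.
have a0 : a != 0 by apply: contraTneq D0 => a0; rewrite /D a0 mulr0 mul0r sub0r oppr_gt0 -leNgt sqr_ge0.
have ac : 0 < 4 * (`|a| + `|c|) by rewrite mulr_gt0 // ltr_wpDr // normr_gt0.
exists (D / (4 * (`|a| + `|c|))); first exact: divr_gt0.
move=> x y; rewrite mulrAC ler_pdivrMr //; set N := _ + _ + _.
have h1 : D * y ^+ 2 <= 4 * (`|N| * `|a|).
  rewrite -normrM; apply: (@le_trans _ _ (4 * (N * a))); last by rewrite ler_wpM2l // ler_norm.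
  by have := sqr_ge0 (2 * a * x + b * y); rewrite /N /D; lra.
have h2 : D * x ^+ 2 <= 4 * (`|N| * `|c|).
  rewrite -normrM; apply: (@le_trans _ _ (4 * (N * c))); last by rewrite ler_wpM2l // ler_norm.
  by have := sqr_ge0 (2 * c * y + b * x); rewrite /N /D; lra.
lra.
Qed.

Lemma form_bound (a b c x y : R) :
  `|a * x ^+ 2 + b * (x * y) + c * y ^+ 2| <= (`|a| + `|b| + `|c|) * (x ^+ 2 + y ^+ 2).
Proof.
apply: le_trans (ler_normD _ _) _; apply: le_trans (lerD (ler_normD _ _) (lexx _)) _.
rewrite (normrM a) (normrM b) (normrM c) (normrM x y) (ger0_norm (sqr_ge0 x)) (ger0_norm (sqr_ge0 y)).
have xy : `|x| * `|y| <= x ^+ 2 + y ^+ 2.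
  rewrite -(real_normK (num_real x)) -(real_normK (num_real y)).
  by have := normr_ge0 x; have := normr_ge0 y; nra.
have := ler_wpM2l (normr_ge0 b) xy.
have := mulr_ge0 (normr_ge0 a) (sqr_ge0 y); have := mulr_ge0 (normr_ge0 c) (sqr_ge0 x); lra.
Qed.

(** Multiply the hypothesis by |Re w| and use Re (w^2) <= (Re w)^2. This turns a bound on [p] into
    the sector condition on [p ^+ 2]. *)
Lemma sqr_cone (k : R) (w : R[i]) : 0 < k -> k * `|Re w| <= `|Im w| ->
  2 * k * Re (w ^+ 2) <= `|Im (w ^+ 2)|.
Proof.
case: w => x y /= k0 h.
have -> : `|x * y + y * x| = 2 * (`|x| * `|y|).
  by rewrite [y * x]mulrC -mulr2n normrMn normrM mulr_natl.
have h' := ler_wpM2l (normr_ge0 x) h.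
have xx : k * (`|x| * `|x|) = k * x ^+ 2 by rewrite -expr2 real_normK ?num_real.
have : 0 <= k * y ^+ 2 by rewrite mulr_ge0 ?sqr_ge0 // ltW.
lra.
Qed.
End Forms.

(** * The three planes *)

Section Planes.
Variable R : realType.
Implicit Types (A : 'M[R]_2) (z : 'cV[R[i]]_2).

Lemma mulmx2E (T : pzSemiRingType) (m n : nat) (A : 'M[T]_(m, 2)) (B : 'M[T]_(2, n)) i j :
  (A *m B) i j = A i 0 * B 0 j + A i 1 * B 1 j.
Proof. by rewrite mxE !big_ord_recl big_ord0 addr0; congr (_ * _ + A i _ * B _ j); apply: val_inj. Qed.

Lemma real_planeP z : real_plane R z -> exists x y : R, z 0 0 = x%:C /\ z 1 0 = y%:C.
Proof. by move=> [v _ <-]; exists (v 0 0), (v 1 0); rewrite !mxE. Qed.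

Lemma plane_of_mxP A z : plane_of_mx A z -> exists x y : R,
  z 0 0 = (A 0 0 * x + A 0 1 * y) +i* x /\ z 1 0 = (A 1 0 * x + A 1 1 * y) +i* y.
Proof.
move=> [v _ <-]; exists (v 0 0), (v 1 0); rewrite !mulmx2E !mxE /=.
by split; apply/eqP; rewrite eq_complex /=; apply/andP; split; apply/eqP; ring.
Qed.

Lemma real_plane0 : real_plane R 0.
Proof. by exists 0 => //; rewrite map_mx0. Qed.

Lemma plane_of_mx0 A : plane_of_mx A 0.
Proof. by exists 0 => //; rewrite map_mx0 mulmx0. Qed.

(* The quadratic form [z |-> det (z, A z)]. *)
Definition wedge_form A : mpoly.mpoly 2 R[i] :=
  let X k := mpoly.mpolyX R[i] (mpoly.mnm1 k) in
  let C r := mpoly.mpolyC 2 r%:C in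
  X 0 * (C (A 1 0) * X 0 + C (A 1 1) * X 1) - X 1 * (C (A 0 0) * X 0 + C (A 0 1) * X 1).

Lemma peval_wedge_form A z : peval (wedge_form A) z =
  z 0 0 * ((A 1 0)%:C * z 0 0 + (A 1 1)%:C * z 1 0)
  - z 1 0 * ((A 0 0)%:C * z 0 0 + (A 0 1)%:C * z 1 0).
Proof.
have Xe k : peval (mpoly.mpolyX R[i] (mpoly.mnm1 k)) z = z k 0 by exact: mpoly.mevalXU.
by rewrite !(pevalD, pevalN, pevalM, pevalC, Xe).
Qed.

Lemma det2 A : \det A = A 0 0 * A 1 1 - A 0 1 * A 1 0.
Proof.
rewrite (expand_det_row _ 0) !big_ord_recl big_ord0 addr0 /cofactor !det_mx11 !mxE /=.
have -> : lift ord0 ord0 = 1 :> 'I_2 by exact: val_inj.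
have -> : lift 1 0 = 0 :> 'I_2 by exact: val_inj.
have -> : ord0 = 0 :> 'I_2 by exact: val_inj.
rewrite addn0 expr0 add0n expr1; ring.
Qed.

Lemma tr2 A : \tr A = A 0 0 + A 1 1.
Proof.
rewrite /mxtrace !big_ord_recl big_ord0 addr0.
have -> : lift ord0 ord0 = 1 :> 'I_2 by exact: val_inj.
by [].
Qed.

(* The left-hand side is minus the discriminant of the quadratic form
   [x |-> Im (wedge_form A1 ((A2 + i) x))]. *)
Lemma betaE A1 A2 :
  4 * (2 * A1 1 0 * A2 0 0 + (A1 1 1 - A1 0 0) * A2 1 0)
    * ((A1 1 1 - A1 0 0) * A2 0 1 - 2 * A1 0 1 * A2 1 1)
  - (2 * A1 1 0 * A2 0 1 + (A1 1 1 - A1 0 0) * (A2 0 0 + A2 1 1) - 2 * A1 0 1 * A2 1 0) ^+ 2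
  = 4 * (beta A1 A2 - \det A2 * \tr A1 ^+ 2).
Proof. by rewrite /beta det_mulmx !det2 !tr2 !mulmx2E; field. Qed.

Lemma betaC A B : beta A B = beta B A.
Proof. by rewrite /beta !det_mulmx mxtrace_mulC [\det A * _]mulrC [\tr A * _]mulrC. Qed.

Lemma wedge_form_real_plane A z : real_plane R z -> Im (peval (wedge_form A) z) = 0.
Proof. by move=> /real_planeP[x [y [zx zy]]]; rewrite peval_wedge_form zx zy /=; ring. Qed.

(** [A] commutes with [A + i], so at z = (A + i) x the form is det (A + i) det (x, A x); [t] is the
    second factor. *)
Lemma wedge_form_plane_of_mx A z : plane_of_mx A z -> exists t : R,
  peval (wedge_form A) z = ((\det A - 1) * t) +i* (\tr A * t).
Proof.
move=> /plane_of_mxP[x [y [zx zy]]]; rewrite peval_wedge_form zx zy det2 tr2.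
exists (x * (A 1 0 * x + A 1 1 * y) - y * (A 0 0 * x + A 0 1 * y)).
by apply/eqP; rewrite eq_complex /=; apply/andP; split; apply/eqP; ring.
Qed.

(** By [betaE] the imaginary part is a definite form in the parameters x, y of the plane; everything
    is compared with s = x^2 + y^2. *)
Lemma wedge_form_definite A B : \det B * \tr A ^+ 2 < beta A B ->
  exists C k L : R, [/\ 0 < k, 0 < L & forall z, plane_of_mx B z -> exists s : R,
    [/\ 0 <= s, k * s <= `|Im (peval (wedge_form A) z)|,
       `|Re (peval (wedge_form A) z)| <= C * s & forall j, nrm (z j 0) ^+ 2 <= L * s]].
Proof.
rewrite -subr_gt0 => h.
have {h} : 0 < 4 * (beta A B - \det B * \tr A ^+ 2) by rewrite mulr_gt0.
rewrite -betaE => /definite_form_bound[k k0 hk].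
(* The coefficients of the real part of the form in x and y. *)
pose al := A 1 0 * (B 0 0 ^+ 2 - 1) + (A 1 1 - A 0 0) * B 0 0 * B 1 0 - A 0 1 * B 1 0 ^+ 2.
pose be := 2 * A 1 0 * B 0 0 * B 0 1 + (A 1 1 - A 0 0) * (B 0 0 * B 1 1 + B 0 1 * B 1 0 - 1)
  - 2 * A 0 1 * B 1 0 * B 1 1.
pose ga := A 1 0 * B 0 1 ^+ 2 + (A 1 1 - A 0 0) * B 0 1 * B 1 1 - A 0 1 * (B 1 1 ^+ 2 - 1).
(* |z_i|^2 is enlarged by the missing one of x^2, y^2, so that both coordinates share one
   formula. *)
pose l i := `|B i 0 ^+ 2 + 1| + `|2 * B i 0 * B i 1| + `|B i 1 ^+ 2 + 1|.
have l0 i : 0 <= l i by rewrite !addr_ge0.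
exists (`|al| + `|be| + `|ga|), k, (l 0 + l 1 + 1); split => //.
  by rewrite ltr_wpDl // addr_ge0.
move=> z /plane_of_mxP[x [y [zx zy]]]; exists (x ^+ 2 + y ^+ 2); split.
- by rewrite addr_ge0 ?sqr_ge0.
- apply: le_trans (hk x y) _; rewrite le_eqVlt; apply/orP; left; apply/eqP; congr (`|_|).
  by rewrite peval_wedge_form zx zy /=; ring.
- apply: le_trans (form_bound al be ga x y); rewrite le_eqVlt; apply/orP; left.
  by apply/eqP; congr (`|_|); rewrite peval_wedge_form zx zy /= /al /be /ga; ring.
- move=> j; apply: (@le_trans _ _ (l j * (x ^+ 2 + y ^+ 2))).
    apply: le_trans (form_bound _ _ _ x y); apply: le_trans (ler_norm _).
    have [-> | ->] : j = 0 \/ j = 1 by case: j => [[|[|//]]] i; [left | right]; apply: val_inj.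
      by rewrite sqr_nrm zx /=; have := sqr_ge0 y; lra.
    by rewrite sqr_nrm zy /=; have := sqr_ge0 x; lra.
  apply: ler_wpM2r; first by rewrite addr_ge0 ?sqr_ge0.
  have [-> | ->] : j = 0 \/ j = 1 by case: j => [[|[|//]]] i; [left | right]; apply: val_inj.
    by have := l0 1; lra.
  by have := l0 0; lra.
Qed.

(** Each of the two pieces separated by [kallin] lies in a union of two planes, where a pairwise
    hypothesis controls its hull. *)
Lemma local_polynomial_convexity_of_planes A1 A2 :
  locally_polynomially_convex_at (real_plane R `|` plane_of_mx A1) 0 ->
  locally_polynomially_convex_at (plane_of_mx A1 `|` plane_of_mx A2) 0 ->
  \det A2 * \tr A1 ^+ 2 < beta A1 A2 ->
  locally_polynomially_convex_at (real_plane R `|` plane_of_mx A1 `|` plane_of_mx A2) 0.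
Proof.
set P0 := real_plane R; set P1 := plane_of_mx A1; set P2 := plane_of_mx A2.
have P00 : P0 0 := real_plane0.
have P10 : P1 0 := plane_of_mx0 A1.
have P20 : P2 0 := plane_of_mx0 A2.
move=> l01 l12 h12.
have [|ra ra0 hra] := lpc_hull _ l01; first by left.
have [|rb rb0 hrb] := lpc_hull _ l12; first by left.
have [C [k [L [k0 L0 hP2]]]] := wedge_form_definite h12.
pose r := Num.min ra rb.
have r0 : 0 < r by rewrite lt_min ra0.
have rra z : eclosed_ball 0 r z -> eclosed_ball 0 ra z.
  by move/le_trans; apply; rewrite ge_min lexx.
have rrb z : eclosed_ball 0 r z -> eclosed_ball 0 rb z.
  by move/le_trans; apply; rewrite ge_min lexx orbT.
pose D : set 'cV[R[i]]_2 := eclosed_ball 0 r.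
have D0 : D 0 := eclosed_ball0 2 (ltW r0).
exists r => //; rewrite /polynomially_convex.
set K := (_ `&` _).
have KE : K = (P0 `&` D) `|` (P1 `&` D) `|` (P2 `&` D) by rewrite /K !setIUl.
have bK : coord_bounded K.
  exists r => z [_ Dz] j; move: Dz; rewrite /eclosed_ball /= subr0; apply: le_trans.
  exact: nrm_coord_le_enorm.
rewrite polynomial_hullE; last by exists 0; rewrite KE; left; left.
apply/seteqP; split; last exact: sub_hull.
move=> z0 Yz0; split; last first.
  by apply: (hull_ball (ltW r0)); apply: hull_mono Yz0 => z [].
pose p := wedge_form A1; pose u := p ^+ 2.
have uE z : peval u z = peval p z ^+ 2 by exact: pevalXn.
have uP0 z : Im (peval p z) = 0 -> Im (peval u z) = 0 /\ 0 <= Re (peval u z).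
  rewrite uE; case: (peval p z) => x y /= ->.
  by rewrite !mulr0 mul0r subr0 addr0 -expr2 sqr_ge0.
have P2cone : exists2 m, 0 < m & forall z, P2 z -> m * `|Re (peval p z)| <= `|Im (peval p z)|.
  have C0 : 0 < `|C| + 1 by rewrite ltr_wpDl.
  exists (k / (`|C| + 1)); first exact: divr_gt0.
  move=> z /hP2[s [s0 h1 h2 _]]; apply: le_trans h1; rewrite mulrAC ler_pdivrMr // -mulrA.
  rewrite ler_wpM2l ?(ltW k0) //; apply: le_trans h2 _; rewrite mulrC ler_wpM2l //.
  by apply: le_trans (ler_norm _) _; rewrite lerDl.
have [m [Ka [Kb [[m0 Kab Ka0 Kb0 pKa] [pKb hKa hKb]]]]] : exists m Ka Kb,
    [/\ 0 < m, K = Ka `|` Kb, Ka 0, Kb 0 & forall z, Ka z -> Im (peval p z) = 0] /\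
    [/\ forall z, Kb z -> m * `|Re (peval p z)| <= `|Im (peval p z)|,
     hull Ka `<=` P0 `|` P1 `|` P2 & hull Kb `<=` P0 `|` P1 `|` P2].
  have [m m0 hm] := P2cone.
  (* If the trace vanishes, [p] is real on [P1], which joins [P0]; otherwise [p] maps [P1] into a
     non-real line, and [P1] joins [P2]. *)
  have [tr0|tr0] := eqVneq (\tr A1) 0.
    exists m, (P0 `&` D `|` P1 `&` D), (P2 `&` D); split; split => //; first by left.
    - move=> z [[/wedge_form_real_plane h _]|[/wedge_form_plane_of_mx[t tE] _]]; first exact: h.
      by rewrite /p tE /= tr0 mul0r.
    - by move=> z [/hm].
    - move=> z hz; left; apply: hra hz => w [[h /rra]|[h /rra]] Dw; split => //; by [left | right].
    - move=> z hz; have [] : (P1 `|` P2) z by apply: hrb hz => w [h /rrb]; split => //; right.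
        by left; right.
      by right.
  have d0 : 0 < `|\det A1 - 1| + 1 by rewrite ltr_wpDl.
  have t0 : 0 < `|\tr A1| by rewrite normr_gt0.
  exists (Num.min m (`|\tr A1| / (`|\det A1 - 1| + 1))), (P0 `&` D), (P1 `&` D `|` P2 `&` D).
  split; split => //.
  - by rewrite lt_min m0 divr_gt0.
  - by rewrite KE setUA.
  - by left.
  - by move=> z [/wedge_form_real_plane h _]; exact: h.
  - move=> z [[/wedge_form_plane_of_mx[t tE] _]|[/hm h _]].
      rewrite /p tE /=.
      apply: (@le_trans _ _ (`|\tr A1| / (`|\det A1 - 1| + 1) * `|(\det A1 - 1) * t|)).
        by rewrite ler_wpM2r // ge_min lexx orbT.
      rewrite mulrAC ler_pdivrMr // !normrM -mulrA ler_wpM2l // mulrC ler_wpM2l //.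
      by rewrite lerDl.
    by apply: le_trans h; rewrite ler_wpM2r // ge_min lexx.
  - by move=> z hz; left; apply: hra hz => w [h /rra]; split => //; left.
  - move=> z hz; have [] : (P1 `|` P2) z; last by [left; right|right].
      by apply: hrb hz => w [[h /rrb]|[h /rrb]] Dw; split => //; [left | right].
    by left; right.
have uKb z : Kb z -> 2 * m * Re (peval u z) <= `|Im (peval u z)|.
  by move=> /pKb h; rewrite uE; exact: sqr_cone.
have uKa z (h : Ka z) := uP0 z (pKa z h).
have m2 : 0 < 2 * m by rewrite mulr_gt0.
have [u0|u0] := eqVneq (peval u z0) 0; last first.
  have [] := kallin bK m2 Kab uKa uKb _ _ Yz0 u0; [by exists 0|by exists 0|exact: hKa|exact: hKb].
left; apply: (hra (P0 `&` D `|` P1 `&` D)).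
  by move=> w [[h /rra]|[h /rra]] Dw; split => //; [left | right].
apply: (kallin_zero_fiber bK m2 Kab uKa uKb (E := P2 `&` D)) Yz0 u0.
- by exists 0; left.
- by move=> z; rewrite KE.
(* If |z_j| > d, then s >= d^2 / L, so |p| >= k d^2 / L; squaring gives the bound on [u]. *)
- move=> d d0; exists ((k * (d ^+ 2 / L)) ^+ 2).
    by rewrite exprn_gt0 // mulr_gt0 // divr_gt0 // exprn_gt0.
  move=> z [/hP2[s [s0 h1 _ h2]] _] [j dj]; rewrite uE nrmX.
  have dL : 0 <= k * (d ^+ 2 / L) by rewrite mulr_ge0 ?divr_ge0 ?sqr_ge0 // ltW.
  rewrite lerXn2r ?nnegrE ?nrm_ge0 //; apply: le_trans (normr_Im_le_nrm _).
  apply: le_trans h1; rewrite ler_wpM2l ?(ltW k0) // ler_pdivrMr // mulrC.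
  apply: le_trans (h2 j); rewrite lerXn2r ?nnegrE ?nrm_ge0 ?(ltW dj) // ltW //.
- by left.
Qed.
End Planes.

Theorem theorem3p3 (R : realType) (A1 A2 : 'M[R]_2)
    (P0 P1 P2 : set 'cV[R[i]]_2)
    (defP0 : P0 = real_plane R)
    (defP1 : P1 = plane_of_mx A1)
    (defP2 : P2 = plane_of_mx A2)
    (trP0 : totally_real_plane P0)
    (trP1 : totally_real_plane P1)
    (trP2 : totally_real_plane P2)
    (lpc01 : locally_polynomially_convex_at (P0 `|` P1) 0)
    (lpc02 : locally_polynomially_convex_at (P0 `|` P2) 0)
    (lpc12 : locally_polynomially_convex_at (P1 `|` P2) 0)
    (det_comm_gt0 : 0 < \det (mx_commutator A1 A2))
    (detA1_lt0 : \det A1 < 0)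
    (detA2_lt0 : \det A2 < 0)
    (beta_gt : Num.min (\det A2 * \tr A1 ^+ 2) (\det A1 * \tr A2 ^+ 2)
               < beta A1 A2) :
  locally_polynomially_convex_at (P0 `|` P1 `|` P2) 0.
Proof.
move: beta_gt; rewrite gt_min defP0 defP1 defP2 in lpc01 lpc02 lpc12 * => /orP[h|h].
  exact: local_polynomial_convexity_of_planes.
(* [beta] is symmetric, so this alternative is the previous one with [A1] and [A2] exchanged. *)
rewrite -setUA [plane_of_mx A1 `|` _]setUC setUA.
rewrite setUC in lpc12; rewrite betaC in h.
exact: local_polynomial_convexity_of_planes.
Qed.
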